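(* For every integer $p\ge0$, $$\sum_{k=1}^\infty\frac{1}{(6k-1)(6k)^{2p+1}(6k+1)}-\frac12\left(\sum_{k=1}^\infty\frac{1}{(6k+1)(6k+2)^{2p+1}(6k+3)}+\sum_{k=1}^\infty\frac{1}{(6k+3)(6k+4)^{2p+1}(6k+5)}\right)$$ $$=\frac13\cdot\frac{1}{2^{2p+2}}+\frac1{15}\cdot\frac{1}{2^{4p+3}}-\frac12+\frac38\ln 3+\frac14\sum_{j=1}^p\frac{1-3^{-2j}}{2^{2j}}\zeta(2j+1),$$ and $$\sum_{k=0}^\infty\frac{1}{(6k+1)(6k+2)^{2p+1}(6k+3)}-\sum_{k=0}^\infty\frac{1}{(6k+3)(6k+4)^{2p+1}(6k+5)}=\frac{\sqrt3\,\pi}{36}-\frac{\sqrt3}{3}\sum_{j=1}^p\frac{(-1)^{j+1}\pi^{2j+1}}{(2j+1)!}B_{2j+1}(1/3).$$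
   Context: $\zeta$ is the Riemann zeta function; $B_n(y)$ are the Bernoulli polynomials, defined by $\frac{te^{yt}}{e^t-1}=\sum_{k\ge0}B_k(y)\frac{t^k}{k!}$. Empty sums are $0$. *)

(* Defs.v *)
From Stdlib Require Import Reals Lra List.
From Coquelicot Require Import Coquelicot.
Open Scope R_scope.

Definition zeta (s : nat) : R := Series (fun n => / (INR (n + 1)) ^ s).

(* Bernoulli polynomials.  From t e^{yt} = (e^t - 1) * sum_k B_k(y) t^k/k!,
   comparing coefficients of t^{n+1}:  sum_{k=0}^{n} C(n+1,k) B_k(y) = (n+1) y^n,
   i.e. B_0(y) = 1 and
   B_n(y) = y^n - 1/(n+1) * sum_{k=0}^{n-1} C(n+1,k) B_k(y).
   bern_list n y = [B_0(y); ...; B_n(y)]. *)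
Fixpoint bern_list (n : nat) (y : R) : list R :=
  match n with
  | O => 1 :: nil
  | S m =>
      let l := bern_list m y in
      l ++ (y ^ (S m) - / INR (S m + 1) *
              sum_f_R0 (fun k => Binomial.C (S m + 1) k * nth k l 0) m) :: nil
  end.

Definition bernoulli_poly (n : nat) (y : R) : R := nth n (bern_list n y) 0.

(* Main.v *)
(* Since 1/(y^(s+2) (y^2-1)) = 1/(y^s (y^2-1)) - 1/y^(s+2), raising p by one
   changes both left-hand sides by sums of 1/(6k+a)^(2p+3), which are multiples
   of zeta(2p+3) in the first identity and of the Dirichlet L-value
   L(chi_3, 2p+3) in the second.  For p = 0 the first identity reduces by
   partial fractions to H_(3n) - H_n -> ln 3, and the second to L(chi_3, 1).

   The values L(chi_3, 2j+1) are read off at x = 1/3 from the Fourier series of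
   the Bernoulli polynomials on [0, 1].  With b_m = B_m/m!, the truncation errors
     e_m(x) = b_m(x) + 2 sum_(n <= N+1) cos(2 pi n x - m pi/2) / (2 pi n)^m
   satisfy e_(m+1)' = e_m, and e_0 is the Dirichlet kernel.  Integrating it once
   gives e_1(x) = O(1/(N x)) on (0, 1/2], integrating again gives
   e_2 = O(ln N / N) uniformly on [0, 1].  For m >= 2, e_(m+1)(0) = e_(m+1)(1)
   forces e_m to vanish somewhere in [0, 1], so the uniform bound passes from
   e_m to e_(m+1) by the mean value theorem. *)
Require Import Defs.
From Stdlib Require Import Reals Lra Lia List Arith Factorial.
From Coquelicot Require Import Coquelicot.
Open Scope R_scope.

(** * Bernoulli polynomials *)

Lemma length_bern_list n y : length (bern_list n y) = S n.
Proof.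
  induction n as [|n IH]; simpl; [reflexivity|].
  rewrite length_app, IH; simpl; lia.
Qed.

Lemma nth_bern_list k n y :
  (k <= n)%nat -> nth k (bern_list n y) 0 = bernoulli_poly k y.
Proof.
  induction n as [|n IH]; intros Hk.
  - now replace k with 0%nat by lia.
  - destruct (Nat.eq_dec k (S n)) as [->|Hne]; [reflexivity|].
    rewrite <- IH by lia; simpl.
    rewrite app_nth1; [reflexivity|rewrite length_bern_list; lia].
Qed.

Lemma bernoulli_poly_S n y :
  bernoulli_poly (S n) y =
  y ^ S n - / INR (S n + 1) *
    sum_f_R0 (fun k => Binomial.C (S n + 1) k * bernoulli_poly k y) n.
Proof.
  unfold bernoulli_poly at 1; simpl bern_list.
  rewrite app_nth2; rewrite length_bern_list; [|lia].
  rewrite Nat.sub_diag; cbn [nth].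
  do 2 f_equal; apply sum_eq; intros k Hk; now rewrite nth_bern_list.
Qed.

(** With this normalisation differentiation lowers the index by one without a factor, and the
    recursion becomes a convolution with 1/m!. *)
Definition bern (k : nat) (y : R) : R := bernoulli_poly k y / INR (fact k).

(** This compares the coefficients of t^(n+2) in (e^t - 1) sum_k b_k(y) t^k = t e^(yt), solved for
    the last term b_(n+1). *)
Lemma bern_S n y :
  bern (S n) y =
  y ^ S n / INR (fact (S n)) -
  sum_f_R0 (fun k => bern k y / INR (fact (S (S n) - k))) n.
Proof.
  unfold bern at 1; rewrite bernoulli_poly_S.
  unfold Rdiv; rewrite Rmult_minus_distr_r; f_equal.
  rewrite (Rmult_comm (/ INR (S n + 1))), Rmult_assoc, Rmult_comm, scal_sum.
  apply sum_eq; intros k Hk; unfold Binomial.C, bern, Rdiv.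
  replace (S n + 1)%nat with (S (S n)) by lia.
  rewrite (fact_simpl (S n)), mult_INR.
  pose proof (INR_fact_neq_0 (S n)); pose proof (INR_fact_neq_0 k).
  pose proof (INR_fact_neq_0 (S (S n) - k)).
  pose proof (not_0_INR (S (S n))); field; repeat split; auto.
Qed.

Lemma bern_0 y : bern 0 y = 1.
Proof. unfold bern, bernoulli_poly; simpl; lra. Qed.

Lemma bern_1 y : bern 1 y = y - / 2.
Proof. rewrite bern_S; simpl; rewrite bern_0; field. Qed.

Lemma is_derive_pow_fact n y :
  is_derive (fun t => t ^ S n / INR (fact (S n))) y (y ^ n / INR (fact n)).
Proof.
  replace (y ^ n / INR (fact n)) with (INR (S n) * y ^ n / INR (fact (S n))).
  - generalize (INR (fact (S n))); intros c.
    auto_derive; [exact I|]; change (Nat.pred (S n)) with n.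
    change (match n with 0%nat => 1 | S _ => INR n + 1 end) with (INR (S n)).
    unfold Rdiv; ring.
  - rewrite fact_simpl, mult_INR.
    pose proof (INR_fact_neq_0 n); pose proof (not_0_INR (S n)); field; auto.
Qed.

Lemma is_derive_sum_f_R0 (f : nat -> R -> R) (d : nat -> R) n y :
  (forall k, (k <= n)%nat -> is_derive (f k) y (d k)) ->
  is_derive (fun t => sum_f_R0 (fun k => f k t) n) y (sum_f_R0 d n).
Proof.
  induction n as [|n IH]; intros H; simpl; [now apply H|].
  apply (is_derive_plus (fun t => sum_f_R0 (fun k => f k t) n) (f (S n))); auto.
Qed.

(** Strong induction: differentiating the recursion for b_(n+1) term by term gives the recursion for
    b_n. *)
Lemma is_derive_bern n y : is_derive (bern (S n)) y (bern n y).
Proof.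
  revert y; induction n as [n IH] using lt_wf_ind; intros y.
  apply is_derive_ext with
    (f := fun t => minus (t ^ S n / INR (fact (S n)))
      (sum_f_R0 (fun k => bern k t / INR (fact (S (S n) - k))) n)).
  { intros t; symmetry; apply bern_S. }
  (* [d k] is the derivative of the k-th term. Since b_0 = 1 is constant, [d 0] is 0, and dropping
     it shifts the index by one. *)
  set (d k := match k with
    | O => 0 | S k' => bern k' y / INR (fact (S (S n) - k)) end).
  replace (bern n y) with (minus (y ^ n / INR (fact n)) (sum_f_R0 d n)).
  - apply (is_derive_minus (V := R_NormedModule)).
    + apply is_derive_pow_fact.
    + apply is_derive_sum_f_R0; intros [|k] Hk; unfold d.
      * apply is_derive_ext with (f := fun _ => 1 / INR (fact (S (S n) - 0))).
        { intros t; now rewrite bern_0. }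
        apply (is_derive_const (V := R_NormedModule)).
      * unfold Rdiv; rewrite Rmult_comm.
        apply is_derive_ext with
          (f := fun t => scal (/ INR (fact (S (S n) - S k))) (bern (S k) t)).
        { intros t; apply Rmult_comm. }
        apply (is_derive_scal (bern (S k))); apply IH; lia.
  - destruct n as [|n].
    + rewrite bern_0; unfold d, minus, plus, opp; simpl; lra.
    + rewrite bern_S, decomp_sum by lia; unfold d at 1.
      rewrite Rplus_0_l; reflexivity.
Qed.

(** Taylor expansion at 0. The difference [F] of the two sides vanishes at 0, and by the induction
    hypothesis its derivative is 0. *)
Lemma bern_taylor n h :
  sum_f_R0 (fun k => bern k 0 * (h ^ (n - k) / INR (fact (n - k)))) n = bern n h.
Proof.
  revert h; induction n as [|n IH]; intros h.
  - simpl; rewrite !bern_0; field.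
  - set (F t := sum_f_R0
      (fun k => bern k 0 * (t ^ (S n - k) / INR (fact (S n - k)))) (S n)
      - bern (S n) t).
    assert (HF : forall t, is_derive F t 0).
    { intros t; replace 0 with (minus (bern n t + 0) (bern n t))
        by (unfold minus, plus, opp; simpl; ring).
      apply (is_derive_minus (V := R_NormedModule)); [|apply is_derive_bern].
      cbn [sum_f_R0]; rewrite <- IH.
      apply (is_derive_plus (V := R_NormedModule)).
      - apply is_derive_sum_f_R0; intros k Hk.
        apply (is_derive_scal (fun t => t ^ (S n - k) / INR (fact (S n - k)))).
        replace (S n - k)%nat with (S (n - k)) by lia; apply is_derive_pow_fact.
      - rewrite Nat.sub_diag; auto_derive; [exact I|simpl; ring]. }
    assert (F0 : F 0 = 0).
    { unfold F; cbn [sum_f_R0]; rewrite Nat.sub_diag.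
      rewrite (sum_eq _ (fun _ => 0)), sum_cte; [simpl; field|].
      intros k Hk; rewrite pow_ne_zero by lia; unfold Rdiv; ring. }
    destruct (MVT_gen F 0 h (fun _ => 0)) as [c [_ Hc]].
    + intros; apply HF.
    + intros x _; apply continuity_pt_filterlim.
      apply (ex_derive_continuous F); eexists; apply HF.
    + unfold F in Hc at 1; lra.
Qed.

(** Expand at 0 with h = 1. The recursion at y = 0 makes all terms except the last, b_(n+2)(0), add
    up to 0^(n+1)/(n+1)! = 0. *)
Lemma bern_periodic n : bern (S (S n)) 1 = bern (S (S n)) 0.
Proof.
  rewrite <- (bern_taylor _ 1); cbn [sum_f_R0].
  pose proof (bern_S n 0) as H; rewrite pow_ne_zero in H by lia.
  rewrite (sum_eq _ (fun k => bern k 0 / INR (fact (S (S n) - k)))); cycle 1.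
  { intros k _; rewrite pow1; unfold Rdiv; ring. }
  rewrite H; replace (S (S n) - S n)%nat with 1%nat by lia; rewrite Nat.sub_diag.
  simpl (1 ^ _); simpl (INR (fact 1)); simpl (INR (fact 0)).
  unfold Rdiv; rewrite Rmult_0_l, Rinv_1; ring.
Qed.

(** * Fourier series of the Bernoulli polynomials *)

Definition fourier_err (m N : nat) (x : R) : R :=
  bern m x +
  2 * sum_f_R0 (fun n => cos (2 * PI * INR (S n) * x - INR m * (PI / 2))
                         / (2 * PI * INR (S n)) ^ m) N.

Lemma freq_pos n : 0 < 2 * PI * INR (S n).
Proof.
  pose proof PI_RGT_0.
  apply Rmult_lt_0_compat; [lra|apply lt_0_INR; lia].
Qed.

(** One derivative advances the phase by a quarter turn and cancels one power of the frequency, in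
    step with b_(m+1)' = b_m. *)
Lemma is_derive_fourier_err m N x :
  is_derive (fourier_err (S m) N) x (fourier_err m N x).
Proof.
  unfold fourier_err.
  apply (is_derive_plus (V := R_NormedModule)); [apply is_derive_bern|].
  apply (is_derive_scal (fun t => sum_f_R0 _ N)).
  apply is_derive_sum_f_R0; intros n _.
  pose proof (freq_pos n) as Hw.
  rewrite (S_INR m).
  replace (INR m * (PI / 2)) with ((INR m + 1) * (PI / 2) - PI / 2) by ring.
  revert Hw; generalize (2 * PI * INR (S n)), ((INR m + 1) * (PI / 2)).
  intros w a Hw.
  replace (w * x - (a - PI / 2)) with (PI / 2 + (w * x - a)) by ring.
  rewrite cos_plus, cos_PI2, sin_PI2.
  auto_derive; [exact I|].
  assert (w ^ m <> 0) by (apply pow_nonzero; lra).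
  simpl; change (w * x - a) with (w * x + - a); field; split; [auto|lra].
Qed.

Lemma fourier_err_periodic m N :
  fourier_err (S (S m)) N 1 = fourier_err (S (S m)) N 0.
Proof.
  unfold fourier_err; rewrite bern_periodic; do 2 f_equal.
  apply sum_eq; intros n _; f_equal.
  rewrite <- (cos_period (2 * PI * INR (S n) * 0 - _) (S n)); f_equal; ring.
Qed.

(** Dirichlet kernel 1 + 2 sum cos(2 pi n x), by induction from 2 sin u cos t = sin(t + u) - sin(t -
    u) with u = pi x. *)
Lemma fourier_err_0 N x :
  sin (PI * x) * fourier_err 0 N x = sin (INR (2 * N + 3) * (PI * x)).
Proof.
  unfold fourier_err; rewrite bern_0.
  induction N as [|N IH].
  - cbn [sum_f_R0]; replace (2 * 0 + 3)%nat with 3%nat by lia.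
    replace (INR 3 * (PI * x)) with (2 * (PI * x) + PI * x) by (simpl; ring).
    replace (2 * PI * INR 1 * x - INR 0 * (PI / 2)) with (2 * (PI * x))
      by (simpl; ring).
    rewrite sin_plus, cos_2a_sin, sin_2a.
    pose proof (cos2 (PI * x)) as H; unfold Rsqr in H.
    transitivity (2 * sin (PI * x) * (cos (PI * x) * cos (PI * x))
      + (1 - 2 * sin (PI * x) * sin (PI * x)) * sin (PI * x)); [|ring].
    rewrite H; simpl; field.
  - rewrite tech5, (Rmult_plus_distr_l 2), <- Rplus_assoc, Rmult_plus_distr_l, IH.
    set (t := 2 * PI * INR (S (S N)) * x - INR 0 * (PI / 2)).
    replace (INR (2 * N + 3) * (PI * x)) with (t - PI * x).
    2:{ unfold t; rewrite plus_INR, mult_INR, !S_INR; simpl; ring. }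
    replace (INR (2 * S N + 3) * (PI * x)) with (t + PI * x).
    2:{ unfold t; rewrite plus_INR, mult_INR, !S_INR; simpl; ring. }
    rewrite sin_plus, sin_minus, pow_O; field.
Qed.

(** In odd order the Fourier terms are sines, with a sign depending on the order. *)
Lemma cos_sub_odd_quarter t j :
  cos (t - INR (2 * j + 1) * (PI / 2)) = (-1) ^ j * sin t.
Proof.
  induction j as [|j IH].
  - simpl; rewrite Rmult_1_l, Rmult_1_l, cos_minus, cos_PI2, sin_PI2; ring.
  - replace (t - INR (2 * S j + 1) * (PI / 2))
      with (t - INR (2 * j + 1) * (PI / 2) - PI).
    2:{ rewrite !plus_INR, !mult_INR, !S_INR; simpl; field. }
    rewrite cos_minus, cos_PI, sin_PI, IH; simpl; ring.
Qed.

(** * Decay of the truncation errors *)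

Lemma nonincreasing_of_derive (f df : R -> R) a b :
  a <= b -> (forall x, a <= x <= b -> is_derive f x (df x)) ->
  (forall x, a <= x <= b -> df x <= 0) -> f b <= f a.
Proof.
  intros Hab Hd Hneg.
  destruct (MVT_gen f a b df) as [c [Hc E]];
    rewrite ?Rmin_left, ?Rmax_right in * by lra.
  - intros x Hx; apply Hd; lra.
  - intros x Hx; apply continuity_pt_filterlim.
    apply (ex_derive_continuous f); eexists; apply Hd; lra.
  - specialize (Hneg c Hc); nra.
Qed.

(** Both f - g and -f - g are nonincreasing. This turns a pointwise bound on a derivative into a
    bound on an increment, in place of an integral. *)
Lemma Rabs_sub_le_of_derive (f df g dg : R -> R) a b :
  a <= b -> (forall x, a <= x <= b -> is_derive f x (df x)) ->
  (forall x, a <= x <= b -> is_derive g x (dg x)) ->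
  (forall x, a <= x <= b -> Rabs (df x) <= dg x) ->
  Rabs (f b - f a) <= g b - g a.
Proof.
  intros Hab Hf Hg H; apply Rabs_le.
  assert (f b - g b <= f a - g a).
  { apply (nonincreasing_of_derive (fun x => minus (f x) (g x))
      (fun x => minus (df x) (dg x))); auto.
    - intros x Hx; apply (is_derive_minus (V := R_NormedModule)); auto.
    - intros x Hx; specialize (H x Hx); apply Rabs_le_between in H.
      unfold minus, plus, opp; simpl; lra. }
  assert (- f b - g b <= - f a - g a).
  { apply (nonincreasing_of_derive (fun x => minus (opp (f x)) (g x))
      (fun x => minus (opp (df x)) (dg x))); auto.
    - intros x Hx; apply (is_derive_minus (V := R_NormedModule)); auto.
      apply (is_derive_opp (V := R_NormedModule)); auto.
    - intros x Hx; specialize (H x Hx); apply Rabs_le_between in H.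
      unfold minus, plus, opp; simpl; lra. }
  lra.
Qed.

(** At 1/2 both b_1 and every sin(pi n) vanish, so integration of e_0 can start there. *)
Lemma fourier_err_1_half N : fourier_err 1 N (/ 2) = 0.
Proof.
  unfold fourier_err; rewrite bern_1, (sum_eq _ (fun _ => 0)), sum_cte; [ring|].
  intros n _.
  replace (cos _) with (sin (INR (S n) * PI)).
  - rewrite (sin_eq_0_1 (INR (S n) * PI)); [unfold Rdiv; ring|].
    exists (Z.of_nat (S n)); now rewrite <- INR_IZR_INZ.
  - transitivity (cos (INR (S n) * PI - INR (2 * 0 + 1) * (PI / 2))).
    + rewrite cos_sub_odd_quarter; ring.
    + f_equal; simpl (2 * 0 + 1)%nat; field.
Qed.

(** For u = pi x <= 2, sin u >= u - u^3/6 >= u/3, and pi >= 3. *)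
Lemma sin_PI_mult_ge x : 0 < x <= / 2 -> x <= sin (PI * x).
Proof.
  intros Hx; pose proof PI_RGT_0; pose proof PI_4; pose proof PI2_3_2 as Hpi.
  assert (Hu0 : 0 < PI * x) by (apply Rmult_lt_0_compat; lra).
  assert (Hu2 : PI * x <= 4 * / 2) by (apply Rmult_le_compat; lra).
  destruct (pre_sin_bound (PI * x) 0) as [H' _]; [lra|lra|].
  unfold sin_approx, sin_term in H'; simpl in H'.
  assert (Hx3 : x * 3 <= PI * x) by nra.
  revert Hu0 Hu2 H' Hx3; generalize (PI * x); intros u.
  intros; apply Rle_trans with (u / 3); [lra|].
  refine (Rle_trans _ _ _ _ H'); field_simplify; nra.
Qed.

(** Integration by parts of sin(K pi t)/sin(pi t) from 1/2 to x, with K = 2N+3: [h] is e_1 with the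
    boundary term -cos(K pi t)/(K pi sin(pi t)) removed. *)
Lemma fourier_err_1_le N x :
  0 < x <= / 2 -> Rabs (fourier_err 1 N x) <= / (INR (2 * N + 3) * x).
Proof.
  intros Hx; pose proof PI_RGT_0 as Hpi.
  set (K := INR (2 * N + 3)).
  assert (HK : 0 < K) by (apply lt_0_INR; lia).
  assert (Hsin : forall t, 0 < t <= / 2 -> 0 < sin (PI * t)).
  { intros t Ht; pose proof (sin_PI_mult_ge t Ht); lra. }
  assert (Hden : forall t, 0 < t <= / 2 -> 0 < K * PI * sin (PI * t)).
  { intros t Ht; apply Rmult_lt_0_compat; [nra|now apply Hsin]. }
  (* [h' = O(cos / (K sin^2))] is the derivative of a multiple of [1 / sin], and
     [h] vanishes at 1/2 because [K] is odd. *)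
  set (h t := fourier_err 1 N t + cos (K * (PI * t)) / (K * PI * sin (PI * t))).
  assert (E : Rabs (h (/ 2) - h x) <=
    - / (K * PI * sin (PI * / 2)) - - / (K * PI * sin (PI * x))).
  { apply (Rabs_sub_le_of_derive h
      (fun t => - (cos (K * (PI * t)) * cos (PI * t) / (K * sin (PI * t) ^ 2)))
      (fun t => - / (K * PI * sin (PI * t)))
      (fun t => cos (PI * t) / (K * sin (PI * t) ^ 2))); [lra| | |].
    - intros t Ht; assert (Hs : 0 < sin (PI * t)) by (apply Hsin; lra).
      replace (- _) with (fourier_err 0 N t +
        (- sin (K * (PI * t)) / sin (PI * t)
         - cos (K * (PI * t)) * cos (PI * t) / (K * sin (PI * t) ^ 2))).
      + apply (is_derive_plus (V := R_NormedModule));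
          [apply is_derive_fourier_err|].
        auto_derive; [apply Rgt_not_eq, Hden; lra|].
        field; repeat split; lra.
      + unfold K; rewrite <- fourier_err_0; field; split; [lra|fold K; lra].
    - intros t Ht; assert (Hs : 0 < sin (PI * t)) by (apply Hsin; lra).
      auto_derive; [apply Rgt_not_eq, Hden; lra|].
      field; repeat split; lra.
    - intros t Ht; assert (Hs : 0 < sin (PI * t)) by (apply Hsin; lra).
      assert (Hc : 0 <= cos (PI * t)).
      { assert (PI * t <= PI * / 2) by (apply Rmult_le_compat_l; lra).
        assert (0 < PI * t) by (apply Rmult_lt_0_compat; lra).
        apply cos_ge_0; lra. }
      assert (0 < / (K * sin (PI * t) ^ 2))
        by (apply Rinv_0_lt_compat, Rmult_lt_0_compat; [lra|now apply pow_lt]).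
      rewrite Rabs_Ropp; unfold Rdiv; rewrite Rmult_assoc, Rabs_mult.
      rewrite (Rabs_right (_ * / _)) by (apply Rle_ge, Rmult_le_pos; lra).
      rewrite <- (Rmult_1_l (_ * / _)) at 2.
      apply Rmult_le_compat_r; [apply Rmult_le_pos; lra|].
      apply Rabs_le, COS_bound. }
  assert (h2 : h (/ 2) = 0).
  { unfold h; rewrite fourier_err_1_half.
    replace (K * (PI * / 2)) with (- (0 - INR (2 * (N + 1) + 1) * (PI / 2))).
    - rewrite cos_neg, cos_sub_odd_quarter, sin_0; unfold Rdiv; ring.
    - unfold K; replace (2 * (N + 1) + 1)%nat with (2 * N + 3)%nat by lia; field. }
  rewrite h2 in E.
  pose proof (sin_PI_mult_ge x Hx) as Hsx.
  assert (0 < / (K * PI * sin (PI * / 2))).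
  { apply Rinv_0_lt_compat, Hden; lra. }
  set (q := / (K * PI * sin (PI * x))) in *.
  assert (Hq : 0 < q).
  { apply Rinv_0_lt_compat, Hden; lra. }
  (* One [q] bounds h(x), the other the removed boundary term. Then sin(pi x) >= x and pi/2 >= 1
     give 2q <= 1/(K x). *)
  apply Rle_trans with (2 * q).
  - apply Rabs_le_between in E.
    unfold h in E; unfold Rdiv in E; fold q in E.
    pose proof (COS_bound (K * (PI * x))); apply Rabs_le; nra.
  - unfold q; pose proof PI2_3_2.
    replace (2 * _) with (/ (K * (PI / 2 * sin (PI * x)))) by (field; lra).
    apply Rinv_le_contravar; [apply Rmult_lt_0_compat; lra|].
    apply Rmult_le_compat_l; nra.
Qed.

(** Each of the N+1 terms of the sum is at most 1 in absolute value, and so is b_1. This crude bound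
    serves near 0, where 1/(K x) blows up. *)
Lemma fourier_err_1_le_linear N x :
  0 <= x <= 1 -> Rabs (fourier_err 1 N x) <= INR (2 * N + 3).
Proof.
  intros Hx; unfold fourier_err; rewrite bern_1.
  replace (INR (2 * N + 3)) with (1 + 2 * (1 * INR (S N))).
  2:{ rewrite plus_INR, mult_INR, S_INR; simpl; ring. }
  eapply Rle_trans; [apply Rabs_triang|]; apply Rplus_le_compat.
  - apply Rabs_le; lra.
  - rewrite Rabs_mult, (Rabs_right 2) by lra; apply Rmult_le_compat_l; [lra|].
    eapply Rle_trans; [apply Rsum_abs|]; rewrite <- sum_cte.
    apply sum_Rle; intros n _; cbv beta.
    assert (Hw : 1 <= 2 * PI * INR (S n)).
    { pose proof PI2_3_2; rewrite S_INR; pose proof (pos_INR n); nra. }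
    unfold Rdiv; rewrite Rabs_mult, pow_1, Rabs_inv, (Rabs_right (_ * INR _)) by lra.
    apply Rle_trans with (1 * 1); [|lra].
    apply Rmult_le_compat; try apply Rabs_pos.
    + left; apply Rinv_0_lt_compat; lra.
    + apply Rabs_le, COS_bound.
    + rewrite <- Rinv_1; apply Rinv_le_contravar; lra.
Qed.

(** With K = 2N+3, the summand 2 ln K / K comes from integrating 1/(K t) from 1/K^2 to 1/2, and 1/K
    from integrating K over [0, 1/K^2]. *)
Definition rate (N : nat) : R :=
  (2 * ln (INR (2 * N + 3)) + 1) / INR (2 * N + 3).

Lemma is_lim_seq_rate : is_lim_seq rate 0.
Proof.
  assert (HK : is_lim_seq (fun N => INR (2 * N + 3)) p_infty).
  { apply (is_lim_seq_subseq INR p_infty (fun N => (2 * N + 3)%nat)).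
    - apply eventually_subseq; intros n; lia.
    - apply is_lim_seq_INR. }
  apply is_lim_seq_ext with
    (fun N => 2 * (ln (INR (2 * N + 3)) / INR (2 * N + 3)) + / INR (2 * N + 3)).
  { intros N; unfold rate, Rdiv; ring. }
  replace 0 with (2 * 0 + 0) by ring; apply is_lim_seq_plus'.
  - apply (is_lim_seq_scal_l _ 2 (Finite 0)).
    apply (is_lim_comp_seq (fun y => ln y / y) _ p_infty (Finite 0)); auto.
    + apply is_lim_div_ln_p.
    + now exists 0%nat.
  - apply (is_lim_seq_inv _ p_infty); [exact HK|discriminate].
Qed.

(* Uses |e_1| <= 1/(K t) for t >= 1/K^2 and |e_1| <= K for t <= 1/K^2, where
   K = 2N+3. *)
Lemma fourier_err_2_sub_half N x :
  0 <= x <= / 2 -> Rabs (fourier_err 2 N (/ 2) - fourier_err 2 N x) <= rate N.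
Proof.
  unfold rate; set (K := INR (2 * N + 3)).
  assert (HK : 3 <= K) by (replace 3 with (INR 3) by (simpl; ring); apply le_INR; lia).
  assert (HlnK : 0 < ln K) by (rewrite <- ln_1; apply ln_increasing; lra).
  assert (HK2 : 0 < / K ^ 2 <= / 2).
  { split; [apply Rinv_0_lt_compat, pow_lt; lra|].
    apply Rinv_le_contravar; nra. }
  assert (far : forall y, / K ^ 2 <= y <= / 2 ->
    Rabs (fourier_err 2 N (/ 2) - fourier_err 2 N y) <= 2 * ln K / K).
  { intros y Hy.
    apply Rle_trans with (ln (/ 2) / K - ln y / K).
    - apply (Rabs_sub_le_of_derive (fourier_err 2 N) (fourier_err 1 N)
        (fun t => ln t / K) (fun t => / (K * t))); [lra| | |].
      + intros; apply is_derive_fourier_err.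
      + intros t Ht; auto_derive; [lra|field; lra].
      + intros t Ht; apply fourier_err_1_le; lra.
    - unfold Rdiv; rewrite <- Rmult_minus_distr_r.
      apply Rmult_le_compat_r; [left; apply Rinv_0_lt_compat; lra|].
      assert (ln (/ K ^ 2) <= ln y) by (apply ln_le; lra).
      assert (ln (/ 2) <= ln 1) by (apply ln_le; lra).
      rewrite ln_1 in *; rewrite ln_Rinv, ln_pow in * by (try apply pow_lt; lra).
      simpl INR in *; lra. }
  assert (HiK : 0 < / K) by (apply Rinv_0_lt_compat; lra).
  intros Hx; unfold Rdiv; rewrite Rmult_plus_distr_r, Rmult_1_l.
  destruct (Rle_lt_dec (/ K ^ 2) x) as [H|H].
  - specialize (far x); unfold Rdiv in far; lra.
  - replace (_ - _) with
      ((fourier_err 2 N (/ 2) - fourier_err 2 N (/ K ^ 2)) +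
       (fourier_err 2 N (/ K ^ 2) - fourier_err 2 N x)) by ring.
    eapply Rle_trans; [apply Rabs_triang|]; apply Rplus_le_compat.
    + apply far; lra.
    + apply Rle_trans with (K * / K ^ 2 - K * x).
      * apply (Rabs_sub_le_of_derive (fourier_err 2 N) (fourier_err 1 N)
          (fun t => K * t) (fun t => K)); [lra| | |].
        -- intros; apply is_derive_fourier_err.
        -- intros t Ht; auto_derive; [exact I|ring].
        -- intros t Ht; apply fourier_err_1_le_linear; lra.
      * replace (K * / K ^ 2) with (/ K) by (field; lra); nra.
Qed.

(** Carries the estimate on [0, 1/2] over to [1/2, 1]. *)
Lemma fourier_err_2_symm N x : fourier_err 2 N (1 - x) = fourier_err 2 N x.
Proof.
  unfold fourier_err; rewrite !bern_S; cbn [sum_f_R0]; rewrite bern_0, bern_1, bern_0, bern_1.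
  f_equal; [simpl; field|]; f_equal.
  apply sum_eq; intros n _; f_equal.
  replace (INR 2 * (PI / 2)) with PI by (simpl; field).
  rewrite !cos_minus, cos_PI, sin_PI.
  rewrite <- (cos_neg (_ * x)), <- (cos_period (- _) (S n)).
  replace (2 * PI * INR (S n) * (1 - x)) with
    (- (2 * PI * INR (S n) * x) + 2 * INR (S n) * PI) by ring.
  ring.
Qed.

Lemma fourier_err_zero m N : exists c, 0 <= c <= 1 /\ fourier_err (S m) N c = 0.
Proof.
  destruct (MVT_gen (fourier_err (S (S m)) N) 0 1 (fourier_err (S m) N))
    as [c [Hc E]]; rewrite ?Rmin_left, ?Rmax_right in * by lra.
  - intros; apply is_derive_fourier_err.
  - intros x _; apply continuity_pt_filterlim.
    apply (ex_derive_continuous (fourier_err _ N)); eexists.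
    apply is_derive_fourier_err.
  - exists c; split; [lra|]; rewrite fourier_err_periodic in E; lra.
Qed.

Lemma fourier_err_le m N x :
  0 <= x <= 1 -> Rabs (fourier_err (S (S m)) N x) <= 2 * rate N.
Proof.
  revert x; induction m as [|m IH]; intros x Hx.
  - assert (near : forall y, 0 <= y <= 1 ->
      Rabs (fourier_err 2 N (/ 2) - fourier_err 2 N y) <= rate N).
    { intros y Hy; destruct (Rle_lt_dec y (/ 2)).
      - apply fourier_err_2_sub_half; lra.
      - rewrite <- (fourier_err_2_symm N y); apply fourier_err_2_sub_half; lra. }
    (* Passing from x to the zero [c] through 1/2 costs [rate N] twice. In higher orders |x - c| <=
       1 preserves the constant 2. *)
    destruct (fourier_err_zero 1 N) as [c [Hc E]].
    pose proof (near x Hx) as H1; pose proof (near c Hc) as H2.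
    rewrite E in H2; apply Rabs_le_between in H1, H2; apply Rabs_le; lra.
  - destruct (fourier_err_zero (S (S m)) N) as [c [Hc E]].
    destruct (MVT_gen (fourier_err (S (S (S m))) N) c x (fourier_err (S (S m)) N))
      as [z [Hz D]].
    + intros; apply is_derive_fourier_err.
    + intros y _; apply continuity_pt_filterlim.
      apply (ex_derive_continuous (fourier_err _ N)); eexists.
      apply is_derive_fourier_err.
    + rewrite E, Rminus_0_r in D; rewrite D, Rabs_mult, <- (Rmult_1_r (2 * _)).
      assert (0 <= z <= 1).
      { unfold Rmin, Rmax in Hz; destruct (Rle_dec c x); lra. }
      apply Rmult_le_compat; try apply Rabs_pos; [now apply IH|].
      apply Rabs_le; lra.
Qed.

Lemma is_lim_seq_fourier_err m x :
  0 < x <= / 2 -> is_lim_seq (fun N => fourier_err (S m) N x) 0.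
Proof.
  intros Hx; apply is_lim_seq_abs_0.
  destruct m as [|m].
  - apply is_lim_seq_le_le with (fun _ => 0) (fun N => / x * / INR (2 * N + 3)).
    + intros N; split; [apply Rabs_pos|].
      rewrite <- Rinv_mult, Rmult_comm; now apply fourier_err_1_le.
    + apply is_lim_seq_const.
    + replace 0 with (/ x * 0) by ring; apply (is_lim_seq_scal_l _ _ (Finite 0)).
      apply (is_lim_seq_inv _ p_infty); [|discriminate].
      apply (is_lim_seq_subseq INR p_infty (fun N => (2 * N + 3)%nat)).
      * apply eventually_subseq; intros n; lia.
      * apply is_lim_seq_INR.
  - apply is_lim_seq_le_le with (fun _ => 0) (fun N => 2 * rate N).
    + intros N; split; [apply Rabs_pos|apply fourier_err_le; lra].
    + apply is_lim_seq_const.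
    + replace 0 with (2 * 0) by ring; apply (is_lim_seq_scal_l _ _ (Finite 0)).
      apply is_lim_seq_rate.
Qed.

(** * The values L(chi_3, 2j+1) *)

Lemma sum_f_R0_block (a : nat -> R) m K :
  sum_f_R0 a (S m * K + m) =
  sum_f_R0 (fun k => sum_f_R0 (fun i => a (S m * k + i)%nat) m) K.
Proof.
  induction K as [|K IH].
  - simpl; rewrite Nat.mul_0_r; reflexivity.
  - rewrite tech5, <- IH, (tech2 a (S m * K + m)) by lia; f_equal.
    replace (S m * S K + m - S (S m * K + m))%nat with m by lia.
    apply sum_eq; intros i _; f_equal; lia.
Qed.

(** Up to the factor sqrt 3 / 2, sin(2 pi n/3) is the character chi_3(n), so the Fourier series at
    1/3 is an L-series. *)
Lemma sin_third_turns k :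
  sin (2 * PI * INR (S (3 * k)) * (1 / 3)) = sqrt 3 / 2 /\
  sin (2 * PI * INR (S (3 * k + 1)) * (1 / 3)) = - (sqrt 3 / 2) /\
  sin (2 * PI * INR (S (3 * k + 2)) * (1 / 3)) = 0.
Proof.
  assert (H : forall n, sin (2 * PI * INR (n + 3 * k) * (1 / 3)) =
    sin (2 * PI * INR n * (1 / 3))).
  { intros n; rewrite <- (sin_period (2 * PI * INR n * (1 / 3)) k); f_equal.
    rewrite plus_INR, mult_INR; simpl; field. }
  repeat split.
  - rewrite <- sin_2PI3.
    replace (S (3 * k)) with (1 + 3 * k)%nat by lia; rewrite H; f_equal; simpl; field.
  - replace (S (3 * k + 1)) with (2 + 3 * k)%nat by lia; rewrite H.
    replace (2 * PI * INR 2 * (1 / 3)) with (PI / 3 + PI) by (simpl; field).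
    now rewrite neg_sin, sin_PI3.
  - replace (S (3 * k + 2)) with (3 + 3 * k)%nat by lia; rewrite H.
    replace (2 * PI * INR 3 * (1 / 3)) with (2 * PI) by (simpl; field).
    apply sin_2PI.
Qed.

Lemma is_series_chi3 j :
  is_series (fun k => / INR (3 * k + 1) ^ (2 * j + 1) - / INR (3 * k + 2) ^ (2 * j + 1))
    ((-1) ^ (j + 1) * (2 * PI) ^ (2 * j + 1) / sqrt 3 * bern (2 * j + 1) (1 / 3)).
Proof.
  set (s := (2 * j + 1)%nat); set (u k := _ - _).
  assert (H3 : 0 < sqrt 3) by (apply sqrt_lt_R0; lra).
  assert (HP : 0 < (2 * PI) ^ s) by (apply pow_lt; pose proof PI_RGT_0; lra).
  assert (H1 : (-1) ^ j * (-1) ^ j = 1).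
  { rewrite <- pow_add; replace (j + j)%nat with (2 * j)%nat by lia.
    apply pow_1_even. }
  (* Truncating at 3K+2 keeps the frequencies 1 to 3K+3, that is, K+1 full periods of chi_3. *)
  assert (E : forall K, fourier_err s (3 * K + 2) (1 / 3) =
    bern s (1 / 3) + (-1) ^ j * (sqrt 3 / (2 * PI) ^ s * sum_f_R0 u K)).
  { intros K; unfold fourier_err; f_equal.
    rewrite (sum_f_R0_block _ 2), <- (Rmult_assoc ((-1) ^ j)), !scal_sum.
    apply sum_eq; intros k _; cbn [sum_f_R0]; rewrite Nat.add_0_r.
    unfold s; rewrite !cos_sub_odd_quarter; fold s.
    destruct (sin_third_turns k) as [-> [-> ->]].
    rewrite !Rpow_mult_distr; unfold u.
    replace (S (3 * k)) with (3 * k + 1)%nat by lia.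
    replace (S (3 * k + 1)) with (3 * k + 2)%nat by lia.
    assert (INR (3 * k + 1) ^ s <> 0) by (apply pow_nonzero, not_0_INR; lia).
    assert (INR (3 * k + 2) ^ s <> 0) by (apply pow_nonzero, not_0_INR; lia).
    assert (INR (S (3 * k + 2)) ^ s <> 0) by (apply pow_nonzero, not_0_INR; lia).
    rewrite <- Rpow_mult_distr.
    field; repeat split; auto; lra. }
  change (is_lim_seq (sum_n u) (Finite
    ((-1) ^ (j + 1) * (2 * PI) ^ s / sqrt 3 * bern s (1 / 3)))).
  apply is_lim_seq_ext with (fun K => (-1) ^ j * (2 * PI) ^ s / sqrt 3 *
    (fourier_err s (3 * K + 2) (1 / 3) - bern s (1 / 3))).
  { intros K; rewrite sum_n_Reals, E.
    replace (_ + _ - _) with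
      ((-1) ^ j * (sqrt 3 / (2 * PI) ^ s * sum_f_R0 u K)) by ring.
    transitivity ((-1) ^ j * (-1) ^ j * sum_f_R0 u K); [field; lra|].
    rewrite H1; ring. }
  replace (_ * bern s (1 / 3)) with
    ((-1) ^ j * (2 * PI) ^ s / sqrt 3 * (0 - bern s (1 / 3)))
    by (rewrite pow_add; field; lra).
  apply (is_lim_seq_scal_l _ _ (Finite (0 - bern s (1 / 3)))).
  apply is_lim_seq_minus'; [|apply is_lim_seq_const].
  apply (is_lim_seq_subseq (fun N => fourier_err s N (1 / 3)) _
    (fun K => (3 * K + 2)%nat)).
  - apply eventually_subseq; intros n; lia.
  - unfold s; rewrite Nat.add_1_r; apply is_lim_seq_fourier_err; lra.
Qed.

(** * The series of the theorem *)

Lemma is_series_block (a : nat -> R) (l : R) m :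
  is_series a l ->
  is_series (fun k => sum_f_R0 (fun i => a (S m * k + i)%nat) m) l.
Proof.
  intros H.
  change (is_lim_seq (sum_n (fun k => sum_f_R0 (fun i => a (S m * k + i)%nat) m))
    (Finite l)).
  apply is_lim_seq_ext with (fun K => sum_n a (S m * K + m)).
  { intros K; rewrite !sum_n_Reals; apply sum_f_R0_block. }
  apply (is_lim_seq_subseq (sum_n a) (Finite l) (fun K => (S m * K + m)%nat)).
  - apply eventually_subseq; intros n; lia.
  - exact H.
Qed.

Lemma is_series_telescope (v : nat -> R) (l : R) :
  is_lim_seq v l -> is_series (fun k => v (S k) - v k) (l - v O).
Proof.
  intros H.
  change (is_lim_seq (sum_n (fun k => v (S k) - v k)) (Finite (l - v O))).
  apply is_lim_seq_ext with (fun n => v (S n) - v O).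
  { intros n; rewrite sum_n_Reals; induction n as [|n IH]; [reflexivity|].
    rewrite tech5, <- IH; ring. }
  apply is_lim_seq_minus'; [|apply is_lim_seq_const].
  now apply (is_lim_seq_incr_1 v).
Qed.

Lemma is_lim_seq_inv_affine c : 0 < c -> forall d, 0 < d ->
  is_lim_seq (fun k => / (c * INR k + d)) 0.
Proof.
  intros Hc d Hd; apply (is_lim_seq_inv _ p_infty); [|discriminate].
  apply is_lim_seq_le_p_loc with (fun k => c * INR k).
  - exists O; intros n _; lra.
  - replace p_infty with (Rbar_mult c p_infty).
    + apply is_lim_seq_scal_l, is_lim_seq_INR.
    + simpl; destruct (Rle_dec 0 c) as [h|]; [|lra].
      destruct (Rle_lt_or_eq_dec 0 c h); [reflexivity|lra].
Qed.

(** Comparison with the telescoping 2/(k+1) - 2/(k+2), which exceeds 1/(k+1)^2 by k/((k+1)^2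
    (k+2)). *)
Lemma ex_series_inv_of_square_le (v : nat -> R) :
  (forall k, (INR k + 1) ^ 2 <= v k) -> ex_series (fun k => / v k).
Proof.
  intros H.
  apply (@ex_series_le R_AbsRing R_CompleteNormedModule _
    (fun k => - 2 * / (1 * INR (S k) + 1) - - 2 * / (1 * INR k + 1))).
  - intros k; specialize (H k); pose proof (pos_INR k).
    assert (0 < (INR k + 1) ^ 2) by (apply pow_lt; lra).
    change (Rabs (/ v k) <= - 2 * / (1 * INR (S k) + 1) - - 2 * / (1 * INR k + 1)).
    rewrite Rabs_right by (apply Rle_ge; left; apply Rinv_0_lt_compat; lra).
    apply Rle_trans with (/ (INR k + 1) ^ 2); [apply Rinv_le_contravar; lra|].
    rewrite S_INR.
    replace (_ - _) with (/ (INR k + 1) ^ 2 + INR k * / ((INR k + 1) ^ 2 * (INR k + 2)))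
      by (field; lra).
    assert (0 < / ((INR k + 1) ^ 2 * (INR k + 2)))
      by (apply Rinv_0_lt_compat, Rmult_lt_0_compat; lra).
    pose proof (Rmult_le_pos (INR k) (/ ((INR k + 1) ^ 2 * (INR k + 2)))); lra.
  - eexists.
    apply (is_series_telescope (fun k => - 2 * / (1 * INR k + 1)) (- 2 * 0)).
    apply (is_lim_seq_scal_l _ _ (Finite 0)), is_lim_seq_inv_affine; lra.
Qed.

(** * Series over residue classes modulo 6 *)

Definition zterm (a : R) (s k : nat) : R := / (6 * INR k + a) ^ s.

(** The middle factor is 6k+a with k from 0. Thus a = 6, 8, 10 give the three sums from k = 1 in the
    first identity, and a = 2, 4 those from k = 0 in the second. *)
Definition uterm (a : R) (p k : nat) : R :=
  / ((6 * INR k + a - 1) * (6 * INR k + a) ^ (2 * p + 1) * (6 * INR k + a + 1)).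

Lemma zterm_eq a s k b x :
  6 * INR k + a = b * x -> zterm a s k = / b ^ s * / x ^ s.
Proof. now unfold zterm; intros ->; rewrite Rpow_mult_distr, Rinv_mult. Qed.

Lemma uterm_eq a p k x y z :
  y = 6 * INR k + a -> x = y - 1 -> z = y + 1 ->
  / (x * y ^ (2 * p + 1) * z) = uterm a p k.
Proof. now intros -> -> ->. Qed.

Lemma ex_series_zterm a s : 1 <= a -> ex_series (zterm a (S (S s))).
Proof.
  intros Ha; apply ex_series_inv_of_square_le; intros k; pose proof (pos_INR k).
  apply Rle_trans with ((6 * INR k + a) ^ 2); [apply pow_incr; lra|].
  apply Rle_pow; [lra|lia].
Qed.

Lemma ex_series_uterm a p : 2 <= a -> ex_series (uterm a p).
Proof.
  intros Ha; apply ex_series_inv_of_square_le; intros k; pose proof (pos_INR k).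
  assert (1 <= (6 * INR k + a) ^ (2 * p + 1)) by (apply pow_R1_Rle; lra).
  rewrite (Rmult_comm (_ - 1)), Rmult_assoc.
  assert ((INR k + 1) ^ 2 <= (6 * INR k + a - 1) * (6 * INR k + a + 1)) by nra.
  assert (0 <= (INR k + 1) ^ 2) by (apply pow2_ge_0); nra.
Qed.

Lemma Series_uterm_S a p : 2 <= a ->
  Series (uterm a (S p)) = Series (uterm a p) - Series (zterm a (2 * p + 3)).
Proof.
  intros Ha.
  rewrite <- Series_minus.
  - apply Series_ext; intros k; unfold uterm, zterm; pose proof (pos_INR k).
    replace (2 * S p + 1)%nat with (2 + (2 * p + 1))%nat by lia.
    replace (2 * p + 3)%nat with (2 + (2 * p + 1))%nat by lia.
    rewrite pow_add.
    assert ((6 * INR k + a) ^ (2 * p + 1) <> 0) by (apply pow_nonzero; lra).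
    field; repeat split; auto; lra.
  - now apply ex_series_uterm.
  - replace (2 * p + 3)%nat with (S (S (2 * p + 1))) by lia.
    apply ex_series_zterm; lra.
Qed.

(** Reduces the classes starting at 8 and 10 to those starting at 2 and 4. *)
Lemma Series_zterm_shift a s : 1 <= a ->
  Series (zterm (a + 6) (S (S s))) = Series (zterm a (S (S s))) - / a ^ S (S s).
Proof.
  intros Ha; rewrite (Series_incr_1 (zterm a (S (S s)))) by now apply ex_series_zterm.
  rewrite (Series_ext (fun k => zterm a (S (S s)) (S k)) (zterm (a + 6) (S (S s)))).
  - unfold zterm at 2; simpl INR; rewrite Rmult_0_r, Rplus_0_l; ring.
  - intros k; unfold zterm; do 2 f_equal; rewrite S_INR; ring.
Qed.

Lemma ex_series_zeta s : ex_series (fun n => / INR (n + 1) ^ S (S s)).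
Proof.
  apply ex_series_inv_of_square_le; intros k; pose proof (pos_INR k).
  rewrite plus_INR; apply Rle_pow; [simpl; lra|lia].
Qed.

Lemma Series_zterm_6 s : Series (zterm 6 s) = / 6 ^ s * zeta s.
Proof.
  unfold zeta; rewrite <- Series_scal_l; apply Series_ext; intros k.
  apply zterm_eq; rewrite plus_INR; simpl; ring.
Qed.

(** The even integers contribute 2^(-t) zeta(t). Grouping them in threes splits this over the
    classes 2, 4 and 6, and the class 6 contributes 6^(-t) zeta(t). *)
Lemma Series_zterm_2_4 s :
  Series (zterm 2 (S (S s))) + Series (zterm 4 (S (S s))) =
  (/ 2 ^ S (S s) - / 6 ^ S (S s)) * zeta (S (S s)).
Proof.
  set (t := S (S s)).
  assert (E : Series (zterm 2 t) + Series (zterm 4 t) + Series (zterm 6 t) =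
    / 2 ^ t * zeta t).
  { unfold t; rewrite <- !Series_plus; try apply ex_series_zterm; try lra.
    2:{ apply (ex_series_plus (V := R_NormedModule)); apply ex_series_zterm; lra. }
    unfold zeta; rewrite <- Series_scal_l.
    apply is_series_unique.
    pose proof (is_series_block (fun n => / 2 ^ t * / INR (n + 1) ^ t)
      (Series (fun n => / 2 ^ t * / INR (n + 1) ^ t)) 2) as B.
    refine (is_series_ext _ _ _ _ (B _)).
    - intros k; cbn [sum_f_R0]; fold t.
      f_equal; [f_equal|]; symmetry; apply zterm_eq;
        rewrite !plus_INR, mult_INR; simpl; ring.
    - apply Series_correct.
      apply (ex_series_scal_l (/ 2 ^ t) (fun n => / INR (n + 1) ^ t)).
      apply ex_series_zeta. }
  rewrite Series_zterm_6 in E; lra.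
Qed.

(** As 6k+2 = 2(3k+1) and 6k+4 = 2(3k+2), this is 2^(-t) L(chi_3, t) with t = 2j+3. *)
Lemma Series_zterm_2_sub_4 j :
  Series (zterm 2 (2 * j + 3)) - Series (zterm 4 (2 * j + 3)) =
  (-1) ^ j * PI ^ (2 * j + 3) / sqrt 3 * bern (2 * j + 3) (1 / 3).
Proof.
  assert (H3 : 0 < sqrt 3) by (apply sqrt_lt_R0; lra).
  pose proof (is_series_chi3 (S j)) as C.
  replace (2 * S j + 1)%nat with (2 * j + 3)%nat in C by lia.
  set (t := (2 * j + 3)%nat) in *.
  assert (Ht : t = S (S (2 * j + 1))) by (unfold t; lia).
  rewrite <- Series_minus by (rewrite Ht; apply ex_series_zterm; lra).
  rewrite (Series_ext _ (fun k => / 2 ^ t *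
    (/ INR (3 * k + 1) ^ t - / INR (3 * k + 2) ^ t))).
  - rewrite Series_scal_l, (is_series_unique _ _ C), Rpow_mult_distr.
    replace (S j + 1)%nat with (2 + j)%nat by lia; rewrite (pow_add (-1)).
    assert (2 ^ t <> 0) by (apply pow_nonzero; lra).
    field; split; [lra|auto].
  - intros k; rewrite Rmult_minus_distr_l.
    f_equal; apply zterm_eq; rewrite plus_INR, mult_INR; simpl; ring.
Qed.

(** In partial fractions the poles at 6k+3 cancel. What remains is half of L(chi_3, 1) with its
    terms grouped in twos, minus a quarter of it ungrouped, hence L(chi_3, 1)/4. *)
Lemma Series_uterm_2_sub_4_0 :
  Series (uterm 2 0) - Series (uterm 4 0) = sqrt 3 * PI / 36.
Proof.
  assert (H3 : 0 < sqrt 3) by (apply sqrt_lt_R0; lra).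
  pose proof (is_series_chi3 0) as C; simpl (2 * 0 + 1)%nat in C.
  pose proof (is_series_block _ _ 1 C) as C2.
  rewrite <- Series_minus by (apply ex_series_uterm; lra).
  apply is_series_unique.
  pose proof (is_series_minus _ _ _ _
    (is_series_scal (/ 2) _ _ C2) (is_series_scal (/ 4) _ _ C)) as D.
  replace (sqrt 3 * PI / 36) with
    (minus (scal (/ 2) ((-1) ^ (0 + 1) * (2 * PI) ^ 1 / sqrt 3 * bern 1 (1 / 3)))
      (scal (/ 4) ((-1) ^ (0 + 1) * (2 * PI) ^ 1 / sqrt 3 * bern 1 (1 / 3)))).
  - refine (is_series_ext _ _ _ _ D); intros k.
    unfold minus, plus, opp, scal; simpl; unfold mult; simpl.
    unfold uterm; rewrite <- !plus_n_O, !plus_INR; simpl.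
    pose proof (pos_INR k); field; repeat split; lra.
  - rewrite bern_1; unfold minus, plus, opp, scal; simpl; unfold mult; simpl.
    apply Rmult_eq_reg_r with (sqrt 3); [|lra].
    replace (sqrt 3 * PI / 36 * sqrt 3) with (sqrt 3 * sqrt 3 * PI / 36) by field.
    rewrite sqrt_sqrt by lra; field; lra.
Qed.

(** * Harmonic numbers and the case p = 0 of the first identity *)

(** In the usual notation this is H_(n+1). *)
Definition harmonic (n : nat) : R := sum_f_R0 (fun k => / INR (S k)) n.

Lemma harmonic_S n : harmonic (S n) = harmonic n + / (INR n + 2).
Proof. unfold harmonic; rewrite tech5, !S_INR; do 2 f_equal; ring. Qed.

Lemma ln_sub_le a b : 0 < a -> 0 < b -> ln b - ln a <= b / a - 1.
Proof.
  intros Ha Hb; rewrite <- ln_div by auto.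
  assert (0 < b / a) by (apply Rdiv_lt_0_compat; auto).
  pose proof (exp_ineq1_le (ln (b / a))) as H'; rewrite exp_ln in H' by auto; lra.
Qed.

(** The sequence decreases, while H_(n+1) - ln(n+2) increases and bounds it from below. The limit is
    Euler's constant, which cancels in differences of harmonic numbers. *)
Lemma ex_lim_harmonic_sub_ln :
  exists l : R, is_lim_seq (fun n => harmonic n - ln (INR n + 1)) l.
Proof.
  assert (H : ex_finite_lim_seq (fun n => harmonic n - ln (INR n + 1))).
  { apply ex_finite_lim_seq_decr with (harmonic 0 - ln 2).
    - intros n; pose proof (pos_INR n); rewrite harmonic_S, S_INR.
      pose proof (ln_sub_le (INR n + 1 + 1) (INR n + 1)) as L.
      replace ((INR n + 1) / (INR n + 1 + 1) - 1) with (- / (INR n + 2)) in L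
        by (field; lra); lra.
    - intros n.
      assert (harmonic 0 - ln 2 <= harmonic n - ln (INR n + 2)).
      { induction n as [|n IH]; [simpl INR; rewrite Rplus_0_l; lra|].
        pose proof (pos_INR n); rewrite harmonic_S, S_INR.
        pose proof (ln_sub_le (INR n + 2) (INR n + 1 + 2)) as L.
        replace ((INR n + 1 + 2) / (INR n + 2) - 1) with (/ (INR n + 2)) in L
          by (field; lra); lra. }
      pose proof (pos_INR n).
      assert (ln (INR n + 1) < ln (INR n + 2)) by (apply ln_increasing; lra); lra. }
  exact H.
Qed.

Lemma is_lim_seq_harmonic_triple :
  is_lim_seq (fun n => harmonic (3 * n + 2) - harmonic n) (ln 3).
Proof.
  destruct ex_lim_harmonic_sub_ln as [l Hl].
  assert (H3 : is_lim_seq (fun n => harmonic (3 * n + 2) - ln (INR (3 * n + 2) + 1)) l).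
  { apply (is_lim_seq_subseq (fun n => harmonic n - ln (INR n + 1)) _
      (fun n => (3 * n + 2)%nat)); auto.
    apply eventually_subseq; intros n; lia. }
  apply is_lim_seq_ext with (fun n => harmonic (3 * n + 2) - ln (INR (3 * n + 2) + 1)
    - (harmonic n - ln (INR n + 1)) + ln 3).
  { intros n; pose proof (pos_INR n).
    replace (INR (3 * n + 2) + 1) with (3 * (INR n + 1))
      by (rewrite plus_INR, mult_INR; simpl; ring).
    rewrite ln_mult by lra; ring. }
  replace (ln 3) with (l - l + ln 3) at 1 by ring.
  apply is_lim_seq_plus'; [|apply is_lim_seq_const].
  now apply is_lim_seq_minus'.
Qed.

Definition boundary_term (k : nat) : R :=
  / 4 * / (6 * INR k + 1) + / 2 * / (6 * INR k + 2) - / 2 * / (6 * INR k + 3)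
  + / 2 * / (6 * INR k + 4) - / 4 * / (6 * INR k + 5).

Lemma uterm_0 a k : 1 < a ->
  uterm a 0 k = / 2 * / (6 * INR k + (a - 1)) - / (6 * INR k + a)
    + / 2 * / (6 * INR k + (a + 1)).
Proof.
  intros Ha; pose proof (pos_INR k); unfold uterm; simpl; field.
  repeat split; lra.
Qed.

(* In the partial fractions on the left, the coefficient of 1/n depends on n mod 6
   only through gcd(n, 6), hence the harmonic numbers; [boundary_term] collects
   the residue classes whose pole is shifted by a full period. *)
Lemma sum_uterm_0 K :
  sum_f_R0 (fun k => uterm 6 0 k - / 2 * (uterm 8 0 k + uterm 10 0 k)) K =
  / 4 * (harmonic (3 * (2 * K + 1) + 2) - harmonic (2 * K + 1))
  + / 8 * (harmonic (3 * K + 2) - harmonic K)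
  + (boundary_term (S K) - boundary_term 0).
Proof.
  induction K as [|K IH].
  - unfold harmonic, boundary_term, uterm; simpl; field.
  - rewrite tech5, IH, !uterm_0 by lra.
    replace (3 * (2 * S K + 1) + 2)%nat
      with (S (S (S (S (S (S (3 * (2 * K + 1) + 2))))))) by lia.
    replace (2 * S K + 1)%nat with (S (S (2 * K + 1))) by lia.
    replace (3 * S K + 2)%nat with (S (S (S (3 * K + 2)))) by lia.
    rewrite !harmonic_S; unfold boundary_term.
    rewrite !S_INR, !plus_INR, !mult_INR, !plus_INR, !mult_INR; simpl INR.
    pose proof (pos_INR K) as HK; revert HK; generalize (INR K); intros x Hx.
    (* Every reciprocal involving [x] is a multiple of some 1/(6x+j) with 7 <= j <= 17. With [r]
       opaque the goal is linear in the values [r j], so [field] clears no large denominators. *)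
    assert (exists r, forall j, r j = / (6 * x + j)) as [r Hr] by (eexists; reflexivity).
    repeat match goal with |- context [/ ?t] =>
      match t with context [x] =>
        let go c j := replace (/ t) with (c * r j)
          by (rewrite Hr; field; repeat split; lra) in
        first [go 1 7 | go 1 8 | go 1 9 | go 1 10 | go 1 11 | go 1 12 | go 1 13
          | go 1 14 | go 1 15 | go 1 16 | go 1 17
          | go 2 8 | go 2 10 | go 2 12 | go 3 9 | go 3 12 | go 6 12]
      end end.
    field.
Qed.

Lemma Series_uterm_6_8_10_0 :
  Series (uterm 6 0) - / 2 * (Series (uterm 8 0) + Series (uterm 10 0)) =
  3 / 8 * ln 3 - 49 / 120.
Proof.
  rewrite <- Series_plus by (apply ex_series_uterm; lra).
  rewrite <- Series_scal_l, <- Series_minus.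
  2:{ apply ex_series_uterm; lra. }
  2:{ apply (ex_series_scal_l (/ 2) (fun k => uterm 8 0 k + uterm 10 0 k)).
      apply (ex_series_plus (V := R_NormedModule)); apply ex_series_uterm; lra. }
  apply is_series_unique.
  change (is_lim_seq (sum_n (fun k =>
    uterm 6 0 k - / 2 * (uterm 8 0 k + uterm 10 0 k)))
    (Finite (3 / 8 * ln 3 - 49 / 120))).
  apply is_lim_seq_ext with
    (1 := fun K => eq_sym (eq_trans (sum_n_Reals _ K) (sum_uterm_0 K))).
  (* Both harmonic differences tend to ln 3, and [boundary_term 0] equals 49/120. *)
  replace (3 / 8 * ln 3 - 49 / 120) with
    (/ 4 * ln 3 + / 8 * ln 3 + (0 - boundary_term 0))
    by (unfold boundary_term; simpl; field).
  apply is_lim_seq_plus'; [apply is_lim_seq_plus'|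
    apply is_lim_seq_minus'; [|apply is_lim_seq_const]].
  - apply (is_lim_seq_scal_l _ _ (Finite (ln 3))).
    apply (is_lim_seq_subseq _ _ (fun K => (2 * K + 1)%nat))
      with (2 := is_lim_seq_harmonic_triple).
    apply eventually_subseq; intros n; lia.
  - apply (is_lim_seq_scal_l _ _ (Finite (ln 3))), is_lim_seq_harmonic_triple.
  - apply (is_lim_seq_incr_1 boundary_term); unfold boundary_term.
    assert (L : forall c d, 0 < d ->
      is_lim_seq (fun k => c * / (6 * INR k + d)) 0).
    { intros c d Hd; replace 0 with (c * 0) by ring.
      apply (is_lim_seq_scal_l _ _ (Finite 0)), is_lim_seq_inv_affine; lra. }
    replace 0 with (0 + 0 - 0 + 0 - 0) by ring.
    apply is_lim_seq_minus'; [apply is_lim_seq_plus'; [apply is_lim_seq_minus';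
      [apply is_lim_seq_plus'|]|]|]; apply L; lra.
Qed.

(** * Both identities by induction on p *)

Theorem theorem9 (p : nat) :
  Series (fun k => let x := 6 * INR (k + 1) in
            / ((x - 1) * x ^ (2 * p + 1) * (x + 1)))
  - / 2 * (Series (fun k => let x := 6 * INR (k + 1) in
                     / ((x + 1) * (x + 2) ^ (2 * p + 1) * (x + 3)))
           + Series (fun k => let x := 6 * INR (k + 1) in
                     / ((x + 3) * (x + 4) ^ (2 * p + 1) * (x + 5))))
  = / 3 * / 2 ^ (2 * p + 2) + / 15 * / 2 ^ (4 * p + 3) - / 2
    + 3 / 8 * ln 3
    + / 4 * sum_f_R0 (fun j => if (j =? 0)%nat then 0 else
                        (1 - / 3 ^ (2 * j)) / 2 ^ (2 * j) * zeta (2 * j + 1)) p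
  /\
  Series (fun k => let x := 6 * INR k in
            / ((x + 1) * (x + 2) ^ (2 * p + 1) * (x + 3)))
  - Series (fun k => let x := 6 * INR k in
              / ((x + 3) * (x + 4) ^ (2 * p + 1) * (x + 5)))
  = sqrt 3 * PI / 36
    - sqrt 3 / 3 * sum_f_R0 (fun j => if (j =? 0)%nat then 0 else
                 (-1) ^ (j + 1) * PI ^ (2 * j + 1) / INR (Factorial.fact (2 * j + 1))
                 * bernoulli_poly (2 * j + 1) (1 / 3)) p.
Proof.
  assert (U : forall (f : nat -> R -> R) (g : nat -> R) a,
    (forall k, f k (g k) = uterm a p k) ->
    Series (fun k => let x := g k in f k x) = Series (uterm a p))
    by (intros f g a H; apply Series_ext; exact H).
  rewrite (U _ _ 6), (U _ _ 8), (U _ _ 10), (U _ _ 2), (U _ _ 4); clear U.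
  2-6: intros k; apply uterm_eq; rewrite ?plus_INR; simpl INR; ring.
  split; induction p as [|p IH].
  (* At p = 0 the rational part is 1/12 + 1/120 - 1/2 = -49/120. *)
  - rewrite Series_uterm_6_8_10_0; simpl; field.
  - rewrite !Series_uterm_S by lra; rewrite tech5.
    pose proof (Series_zterm_shift 2 (2 * p + 1)) as Z8.
    pose proof (Series_zterm_shift 4 (2 * p + 1)) as Z10.
    pose proof (Series_zterm_2_4 (2 * p + 1)) as Z24.
    rewrite Series_zterm_6.
    replace (S (S (2 * p + 1))) with (2 * p + 3)%nat in * by lia.
    replace (2 + 6) with 8 in Z8 by ring; replace (4 + 6) with 10 in Z10 by ring.
    rewrite Z8, Z10 by lra; clear Z8 Z10.
    replace (S p =? 0)%nat with false by reflexivity.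
    replace (2 * S p + 1)%nat with (2 * p + 3)%nat by lia.
    set (z := zeta _) in *.
    (* With t = 2p+3, the coefficient of zeta(t) becomes -6^(-t) + (2^(-t) - 6^(-t))/2 = 2^(-t-1) (1
       - 3^(1-t)). The first terms removed from the classes 2 and 4 account for the change in the
       two powers of 1/2. *)
    match goal with |- ?l = ?r => transitivity
      ((Series (uterm 6 p) - / 2 * (Series (uterm 8 p) + Series (uterm 10 p)))
       - / 6 ^ (2 * p + 3) * z
       + / 2 * (Series (zterm 2 (2 * p + 3)) + Series (zterm 4 (2 * p + 3)))
       - / 2 * (/ 2 ^ (2 * p + 3) + / 4 ^ (2 * p + 3))); [ring|] end.
    rewrite IH, Z24; clear.
    replace 6 with (2 * 3) by ring; replace 4 with (2 * 2) by ring.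
    replace (2 * S p)%nat with (2 + 2 * p)%nat by lia.
    replace (2 + 2 * p + 2)%nat with (4 + 2 * p)%nat by lia.
    replace (2 * p + 3)%nat with (3 + 2 * p)%nat by lia.
    replace (2 * p + 2)%nat with (2 + 2 * p)%nat by lia.
    replace (4 * S p + 3)%nat with (7 + (2 * p + 2 * p))%nat by lia.
    replace (4 * p + 3)%nat with (3 + (2 * p + 2 * p))%nat by lia.
    rewrite !Rpow_mult_distr, !pow_add.
    assert (2 ^ (2 * p) <> 0) by (apply pow_nonzero; lra).
    assert (3 ^ (2 * p) <> 0) by (apply pow_nonzero; lra).
    field; auto.
  - rewrite Series_uterm_2_sub_4_0; simpl; ring.
  - rewrite !Series_uterm_S by lra; rewrite tech5.
    pose proof (Series_zterm_2_sub_4 p) as Z.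
    replace (S p =? 0)%nat with false by reflexivity.
    replace (S p + 1)%nat with (2 + p)%nat by lia.
    replace (2 * S p + 1)%nat with (2 * p + 3)%nat by lia.
    match goal with |- ?a - ?b - (?c - ?d) = _ =>
      replace (a - b - (c - d)) with (a - c - (b - d)) by ring end.
    rewrite IH, Z; unfold bern; rewrite (pow_add (-1)).
    assert (H3 : 0 < sqrt 3) by (apply sqrt_lt_R0; lra).
    (* The L-value carries 1/sqrt 3, the claimed formula sqrt 3 / 3. *)
    assert (Hinv : / sqrt 3 = sqrt 3 * / 3).
    { apply Rmult_eq_reg_r with (sqrt 3); [|lra].
      rewrite Rinv_l by lra.
      transitivity (sqrt 3 * sqrt 3 / 3); [rewrite sqrt_sqrt by lra|]; field. }
    unfold Rdiv; rewrite Hinv; ring.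
Qed.
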